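(* Let $\varphi(s)=c_0s+c_1$ with $c_0\ge2$ an integer and $c_1\in\mathbb C$, $\mathrm{Re}(c_1)\ge0$. Then the composition operator $C_\varphi$ on $\mathcal H^2$ fails to have a minimal commutant.
   Context: $\mathcal H^2$ is the Hilbert space of Dirichlet series $f(s)=\sum_{n\ge1}a_nn^{-s}$ with $\|f\|=(\sum|a_n|^2)^{1/2}<\infty$ (analytic on $\{\mathrm{Re}\,s>1/2\}$), and $C_\varphi f=f\circ\varphi$. For a bounded operator $A$ on a Hilbert space $H$, $\{A\}'=\{T\in\mathcal B(H):TA=AT\}$, $\mathrm{alg}(A)=\{p(A):p\text{ a polynomial}\}$, and $A$ has a minimal commutant if $\overline{\mathrm{alg}(A)}^{\sigma}=\{A\}'$, where $\sigma$ denotes the weak operator topology. *)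

(* Defs.v *)
From HB Require Import structures.
From mathcomp Require Import all_boot all_order all_algebra.
From mathcomp Require Import all_classical all_reals all_analysis.
From mathcomp Require Import complex ring.

Set Implicit Arguments.
Unset Strict Implicit.
Unset Printing Implicit Defensive.

Import Order.TTheory GRing.Theory Num.Theory numFieldNormedType.Exports.
Import Normc.

Local Open Scope classical_set_scope.
Local Open Scope ring_scope.
Local Open Scope complex_scope.

(* [R[i]^o] is the type of complex numbers [R[i]] carrying the usual topology,
   and its structure of vector space over [R[i]].

   The Dirichlet series sum_(n >= 1) a_n n^(-s) is represented by its sequence
   of coefficients, shifted by one: index [n] holds the coefficient of
   [n.+1]^(-s). *)

Section Hardy_space_of_Dirichlet_series.
Variable R : realType.

Definition square_summable (a : nat -> R[i]^o) : Prop :=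
  cvgn (series (fun n => normc (a n) ^+ 2)).

Definition square_summable_pred : {pred nat -> R[i]^o} :=
  fun a => `[< square_summable a >].

Lemma normc_ge0 (z : R[i]) : 0 <= normc z.
Proof. by case: z => x y; exact: sqrtr_ge0. Qed.

Lemma square_summable_submod : submod_closed square_summable_pred.
Proof.
split=> [|c a b /asboolP sa /asboolP sb]; apply/asboolP; rewrite /square_summable.
  rewrite (_ : series _ = fun=> 0); first exact: is_cvg_cst.
  apply/funext => n; rewrite /series /= big1// => i _.
  by rewrite !expr0n addr0 sqrtr0 expr0n.
pose M := (2 * normc c ^+ 2) *: (fun n => normc (a n) ^+ 2) +
  2 *: (fun n => normc (b n) ^+ 2).
have ge0M n : normc (c *: a n + b n) ^+ 2 <= M n.
  have h : normc (c *: a n + b n) <= normc c * normc (a n) + normc (b n).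
    by rewrite (le_trans (le_normcD _ _))// normcM.
  apply: (@le_trans _ _ ((normc c * normc (a n) + normc (b n)) ^+ 2)).
    by rewrite lerXn2r ?nnegrE ?addr_ge0 ?mulr_ge0 ?normc_ge0.
  rewrite -subr_ge0 (_ : M n - _ =
    (normc c * normc (a n) - normc (b n)) ^+ 2) ?sqr_ge0//.
  rewrite -[M n]/((2 * normc c ^+ 2) * normc (a n) ^+ 2 +
    2 * normc (b n) ^+ 2).
  by ring.
apply: (series_le_cvg _ _ ge0M) => [n|n|]; first exact: sqr_ge0.
  by rewrite (le_trans _ (ge0M n))// sqr_ge0.
by apply: is_cvg_seriesD; exact: is_cvg_seriesZ.
Qed.

HB.instance Definition _ :=
  GRing.isSubmodClosed.Build R[i] (nat -> R[i]^o) square_summable_pred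
    square_summable_submod.

Record H2 : Type := MkH2 {
  coef :> nat -> R[i]^o;
  _ : square_summable_pred coef
}.

HB.instance Definition _ := [isSub for coef].
HB.instance Definition _ := [Choice of H2 by <:].
HB.instance Definition _ := [SubChoice_isSubLmodule of H2 by <:].

Definition H2_norm (f : H2) : R :=
  Num.sqrt (limn (series (fun n => normc (f n) ^+ 2))).

Definition H2_dot (f g : H2) : R[i]^o :=
  limn (series (fun n => f n * (g n)^* : R[i]^o)).

Definition cexp (z : R[i]) : R[i] :=
  (expR (complex.Re z))%:C * (cos (complex.Im z) +i* sin (complex.Im z)).

(* value of the Dirichlet series at [s], meaningful for Re s > 1/2, where the
   series converges; [n.+1]^(-s) is written exp (- s ln n.+1) *)
Definition H2_eval (f : H2) (s : R[i]) : R[i]^o :=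
  limn (series (fun n => f n * cexp (- s * (ln n.+1%:R)%:C) : R[i]^o)).

Record bounded_operator : Type := BoundedOperator {
  op_fun :> {linear H2 -> H2};
  op_bounded : exists M : R, forall f : H2, H2_norm (op_fun f) <= M * H2_norm f
}.

HB.instance Definition _ := gen_eqMixin bounded_operator.
HB.instance Definition _ := gen_choiceMixin bounded_operator.

(* the coarsest topology making all the maps T |-> <T f, g> continuous *)
Definition WOT : Type :=
  initial_topology (fun T : bounded_operator =>
    (fun fg : H2 * H2 => H2_dot (T fg.1) fg.2) : {ptws H2 * H2 -> R[i]^o}).

HB.instance Definition _ := Topological.on WOT.

Definition commutant (A : bounded_operator) : set bounded_operator :=
  [set T | forall f, T (A f) = A (T f)].

Definition alg (A : bounded_operator) : set bounded_operator :=
  [set T | exists p : {poly R[i]},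
    forall f, T f = \sum_(k < size p) p`_k *: iter k A f].

Definition minimal_commutant (A : bounded_operator) : Prop :=
  closure (alg A : set WOT) = commutant A.

(* [A] is f |-> f \o phi, as analytic functions on Re s > 1/2; since the values
   of a Dirichlet series on this half-plane determine its coefficients, there
   is at most one such [A] *)
Definition is_composition_operator (phi : R[i] -> R[i]) (A : bounded_operator) :
    Prop :=
  forall (f : H2) (s : R[i]), 2^-1 < complex.Re s ->
    H2_eval (A f) s = H2_eval f (phi s).

End Hardy_space_of_Dirichlet_series.

(* Main.v *)
Require Import Defs.
From HB Require Import structures.
From mathcomp Require Import all_boot all_order all_algebra.
From mathcomp Require Import all_classical all_reals all_analysis.
From mathcomp Require Import complex.
From mathcomp Require Import ring lra.

Import Order.TTheory GRing.Theory Num.Theory.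
Import numFieldNormedType.Exports Normc.

Local Open Scope classical_set_scope.
Local Open Scope ring_scope.
Local Open Scope complex_scope.

(** Write e_n for the Dirichlet series n^(-s). Since
    n^(-(c0 s + c1)) = n^(-c1) (n^c0)^(-s), the composition operator A acts on
    this orthonormal basis by A e_n = n^(-c1) e_(n^c0). The weights have modulus
    at most 1 because Re c1 >= 0, and n |-> n^c0 is injective, so these formulas
    define a contraction ([exists_weighted_shift]), and comparing values shows
    that it is the composition operator ([weighted_shift_composition]).

    An operator with the composition property is determined by it, because a
    Dirichlet series vanishing at all large integers is zero
    ([H2_eval_eq0], [composition_operator_unique]); so every such A has the above
    matrix.

    The commutant of A is larger than the closure of the polynomials in A
    because the basis splits into many orbits of n |-> n^c0. The numbers 2 and 3
    are not c0-th powers, so A f never involves e_2 or e_3; hence <p(A) e_2, e_2>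
    and <p(A) e_3, e_3> both equal p(0), for every polynomial p. The functional
    S |-> <S e_2, e_2> - <S e_3, e_3> is weakly continuous, so it vanishes on the
    closure of the algebra ([closure_alg_coef_eq]). On the other hand n and
    n^c0 have the same parity, so the orthogonal projection T onto the span of
    the e_n with n even commutes with A, while the functional takes the value 1
    at T.

    Coefficients are numbered from zero: index i stands for e_(i + 1). *)

(** * Spreading a sequence along an increasing map of indices *)

Section Push.
Context {V : zmodType} (k : nat -> nat).

(** The sequence carrying [h n] at index [k n] and zero elsewhere. As [n <= k n]
    for increasing [k], the finitely many [n <= m] suffice to find the preimage
    of [m]. *)
Definition push (h : nat -> V) (m : nat) : V :=
  \sum_(n < m.+1 | k n == m) h n.

Hypothesis k_mono : {homo k : m n / (m < n)%N}.

Lemma push_index_ge n : (n <= k n)%N.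
Proof. by elim: n => // n IH; exact: leq_ltn_trans IH (k_mono _ _ (ltnSn n)). Qed.

Lemma push_index_inj : injective k.
Proof. exact: incn_inj (leq_mono k_mono). Qed.

Lemma push_image h n : push h (k n) = h n.
Proof.
have nk : (n < (k n).+1)%N by rewrite ltnS push_index_ge.
rewrite /push (bigD1 (Ordinal nk)) //= big1 ?addr0 // => i /andP[/eqP ki].
by case/eqP; apply: val_inj => /=; exact: push_index_inj.
Qed.

Lemma push_notin h m : (forall n, k n <> m) -> push h m = 0.
Proof. by move=> km; rewrite /push big1 // => i /eqP /km. Qed.

Lemma push_index_spec m : (exists n, m = k n) \/ (forall n, k n <> m).
Proof.
have [[n ->]|no] := pselect (exists n, m = k n); first by left; exists n.
by right=> n kn; apply: no; exists n.
Qed.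

(** [K N] counts the indices that [k] sends below [N]; since [k] is increasing
    these are the first [K N] ones, so the partial sums of [push h] are those of
    [h], with repetitions. *)
Lemma push_count : exists2 K : nat -> nat, K @ \oo --> \oo &
  forall h N, series (push h) N = series h (K N).
Proof.
have /choice [K HK] N : exists K, (forall n, (k n < N)%N = (n < K)%N) /\
    forall h, series (push h) N = series h K.
  elim: N => [|N [K [kK sK]]].
    by exists 0%N; split=> [n|h]; rewrite ?ltn0 // /series /= !big_geq.
  have [kN|kN] := eqVneq (k K) N.
    exists K.+1; split=> [n|h]; last by rewrite !seriesSr sK -kN push_image.
    by rewrite -kN !ltnS (leq_mono k_mono).
  have kN' : (N < k K)%N by rewrite ltn_neqAle eq_sym kN /= leqNgt kK ltnn.
  have below n : (k n < N.+1)%N = (n < K)%N.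
    apply/idP/idP => [|nK]; last by rewrite ltnW // ltnS kK.
    apply: contraLR; rewrite -!leqNgt => Kn.
    by rewrite (leq_trans kN') // (leq_mono k_mono).
  exists K; split=> // h; rewrite seriesSr sK push_notin ?addr0 // => n kn.
  by have := below n; rewrite -kK kn ltnS leqnn ltnn.
exists K => [|h N]; last by case: (HK N).
apply/cvgnyPge => M; exists (k M).+1 => // N /= kMN.
by rewrite ltnW // -(HK N).1.
Qed.

End Push.

Lemma push_comp {V W : zmodType} (k : nat -> nat) (g : V -> W) (h : nat -> V) :
  {homo k : m n / (m < n)%N} -> g 0 = 0 -> g \o push k h = push k (g \o h).
Proof.
move=> k_mono g0; apply/funext => m /=.
have [[n ->]|no] := push_index_spec k m; first by rewrite !push_image.
by rewrite !push_notin.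
Qed.

Lemma cvg_series_push {F : numFieldType} {V : normedModType F} (k : nat -> nat)
    (h : nat -> V) (l : V) :
  {homo k : m n / (m < n)%N} ->
  series h @ \oo --> l -> series (push k h) @ \oo --> l.
Proof.
move=> k_mono hl; have [K Koo sK] := @push_count V k k_mono.
rewrite (_ : series _ = series h \o K); last by apply/funext => N; exact: sK.
exact: cvg_comp Koo hl.
Qed.

(** * Convergence of series of complex numbers *)

Section Complex.
Context {R : realType}.

Lemma normcE (z : R[i]) : `|z| = (normc z)%:C.
Proof. by case: z => x y; rewrite normc_def. Qed.

Lemma normc_le_re z : `|complex.Re z| <= normc (z : R[i]).
Proof. by rewrite -lecR -normcE normc_ge_Re. Qed.

Lemma normc_le_im z : `|complex.Im z| <= normc (z : R[i]).
Proof.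
case: z => x y /=; rewrite -sqrtr_sqr ler_wsqrtr // lerDr; exact: sqr_ge0.
Qed.

Lemma cvg_real_complex (u : nat -> R) (l : R) :
  u @ \oo --> l -> (fun n => (u n)%:C : R[i]^o) @ \oo --> (l%:C : R[i]^o).
Proof.
move=> /cvgrPdist_lt ul; apply/cvgrPdist_lt => -[e e'].
rewrite ltcE /= => /andP[/eqP -> e0]; near=> n.
rewrite -rmorphB normc_def ltcE /= expr0n addr0 sqrtr_sqr eqxx /=.
by near: n; exact: ul.
Unshelve. all: by end_near. Qed.

(** The real and the imaginary parts are dominated by the modulus, so the
    completeness of the real line suffices. *)
Lemma is_cvg_series_normc (u : nat -> R[i]^o) :
  cvgn (series (fun n => normc (u n))) -> cvgn (series u).
Proof.
move=> cu.
have part (p : R[i] -> R) : (forall z, `|p z| <= normc z) ->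
    cvgn (series (p \o u)).
  move=> pn; apply: normed_cvg; apply: series_le_cvg cu => n //=.
  exact: normc_ge0.
have /cvg_ex[a /= ca] := part _ normc_le_re.
have /cvg_ex[b /= cb] := part _ normc_le_im.
apply/cvg_ex; exists ((a%:C : R[i]^o) + ('i%C : R[i]^o) * (b%:C : R[i]^o)).
rewrite (_ : series u = (fun n => (series (@complex.Re R \o u) n)%:C : R[i]^o) \+
  (fun n => ('i%C : R[i]^o) * ((series (@complex.Im R \o u) n)%:C : R[i]^o))).
  apply: cvgD; first exact: cvg_real_complex.
  by apply: cvgMr; exact: cvg_real_complex.
apply/funext => n /=; rewrite /series /= !rmorph_sum /= mulr_sumr -big_split /=.
by apply: eq_bigr => i _; rewrite -complexE.
Qed.

Lemma normc_sum (I : Type) (r : seq I) (P : pred I) (u : I -> R[i]) :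
  normc (\sum_(i <- r | P i) u i) <= \sum_(i <- r | P i) normc (u i).
Proof.
apply: (big_ind2 (fun (z : R[i]) (x : R) => normc z <= x)) => //.
  by rewrite normc0.
by move=> z x w y zx wy; rewrite (le_trans (le_normcD _ _)) // lerD.
Qed.

Lemma series_finite (V : zmodType) (u : nat -> V) (k : nat) :
  (forall n, n != k -> u n = 0) -> forall N, (k < N)%N -> series u N = u k.
Proof.
move=> u0 N kN; rewrite /series /= big_mkord (bigD1 (Ordinal kN)) //=.
by rewrite big1 ?addr0 // => i; exact: u0.
Qed.

Lemma normc_cexp (z : R[i]) : normc (cexp z) = expR (complex.Re z).
Proof.
rewrite normcM /= cos2Dsin2 sqrtr1 mulr1 expr0n addr0 sqrtr_sqr.
by rewrite ger0_norm // expR_ge0.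
Qed.

Lemma cexpD (z w : R[i]) : cexp (z + w) = cexp z * cexp w.
Proof.
case: z w => [a b] [c d]; rewrite /cexp /= expRD cosD sinD.
by apply/eqP; rewrite eq_complex /=; apply/andP; split; apply/eqP; ring.
Qed.

Lemma re_nat (n : nat) : complex.Re (n%:R : R[i]) = n%:R.
Proof. by elim: n => // n IH; rewrite -!natr1 -IH; case: (n%:R : R[i]). Qed.

Lemma re_mul_real (z : R[i]) (x : R) :
  complex.Re (z * x%:C) = complex.Re z * x.
Proof. by case: z => a b /=; rewrite mulr0 subr0. Qed.

Lemma normc_dirichlet (s : R[i]) (n : nat) :
  normc (cexp (- s * (ln n.+1%:R)%:C)) = expR (- complex.Re s * ln n.+1%:R).
Proof. by rewrite normc_cexp re_mul_real; case: s. Qed.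

Lemma expR_ln_nat (j n : nat) :
  expR (- j%:R * ln n.+1%:R) = (n.+1%:R ^- j) :> R.
Proof. by rewrite mulNr expRN expRM_natl lnK // posrE. Qed.

End Complex.

(** * Dirichlet series on the half-plane Re s >= 1 *)

Section Dirichlet.
Context {R : realType}.
Implicit Types f g : H2 R.

Lemma square_summableP f : cvgn (series (fun n => normc (f n) ^+ 2)).
Proof. by case: f => a /= /asboolP. Qed.

(** The partial sums stay below the telescoping bound [2 - 1 / N]. *)
Lemma is_cvg_series_inv_sqr : cvgn (series (fun n => n.+1%:R ^- 2 : R)).
Proof.
apply: nondecreasing_is_cvgn.
  by apply: nondecreasing_series => n _ _; rewrite invr_ge0 exprn_ge0.
exists 2 => _ [N _ <-].
suff le N' : series (fun n => n.+1%:R ^- 2 : R) N'.+1 <= 2 - N'.+1%:R^-1.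
  case: N => [|N]; first by rewrite /series /= big_geq.
  by rewrite (le_trans (le N)) // gerBl invr_ge0.
elim: N' => [|M IH].
  by rewrite /series /= big_nat1 expr1n invr1; lra.
rewrite seriesSr; apply: (le_trans (lerD IH (lexx _))).
have x0 : 0 < M.+1%:R :> R by [].
rewrite -[M.+2%:R]natr1; move: (M.+1%:R : R) x0 => x x0.
rewrite -subr_ge0 (_ : _ - _ = x^-1 * (x + 1) ^- 2); last first.
  by field; apply/andP; split; apply: lt0r_neq0 => //; lra.
by rewrite mulr_ge0 ?invr_ge0 ?exprn_ge0 //; lra.
Qed.

(** By [2 x y <= x ^ 2 + y ^ 2], the general term is dominated by
    [normc (f n) ^ 2 + (n + 1) ^ (-2)]. *)
Lemma is_cvg_dirichlet_norm f (s : R[i]) : 1 <= complex.Re s ->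
  cvgn (series (fun n => normc (f n * cexp (- s * (ln n.+1%:R)%:C)))).
Proof.
move=> s1.
apply: (@series_le_cvg _ _
  ((fun n => normc (f n) ^+ 2) + (fun n => n.+1%:R ^- 2))) => [n|n|n|].
- exact: normc_ge0.
- by rewrite addr_ge0 ?sqr_ge0 // invr_ge0 exprn_ge0.
- rewrite normcM normc_dirichlet.
  set x := normc (f n); set y := expR _.
  have x0 : 0 <= x by exact: normc_ge0.
  have y0 : 0 <= y by exact: expR_ge0.
  have yn : y <= n.+1%:R^-1.
    rewrite -[n.+1%:R^-1]expr1 exprVn -expR_ln_nat ler_expR.
    by rewrite ler_wpM2r ?ln_ge0 ?ler1n // lerN2.
  have yn2 : y ^+ 2 <= n.+1%:R ^- 2 by rewrite -exprVn lerXn2r // nnegrE invr_ge0.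
  rewrite -[leRHS]/(x ^+ 2 + n.+1%:R ^- 2); apply: le_trans (lerD (lexx _) yn2).
  by have := sqr_ge0 (x - y); have := mulr_ge0 x0 y0; lra.
- by apply: is_cvg_seriesD; [exact: square_summableP|exact: is_cvg_series_inv_sqr].
Qed.

Lemma is_cvg_dirichlet f (s : R[i]) : 1 <= complex.Re s ->
  cvgn (series (fun n => f n * cexp (- s * (ln n.+1%:R)%:C) : R[i]^o)).
Proof. by move=> s1; exact/is_cvg_series_normc/is_cvg_dirichlet_norm. Qed.

Lemma H2_evalB f g (s : R[i]) : 1 <= complex.Re s ->
  H2_eval (f - g) s = H2_eval f s - H2_eval g s.
Proof.
move=> s1; rewrite /H2_eval -limB; try exact: is_cvg_dirichlet.
suff -> : series (fun n => (f - g) n * cexp (- s * (ln n.+1%:R)%:C) : R[i]^o) =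
  series (fun n => f n * cexp (- s * (ln n.+1%:R)%:C) : R[i]^o) -
  series (fun n => g n * cexp (- s * (ln n.+1%:R)%:C) : R[i]^o) by [].
apply/funext => N; rewrite -[RHS]/(series _ N - series _ N).
by rewrite /series /= -sumrB; apply: eq_bigr => n _; rewrite -mulrBl.
Qed.

(** The first nonvanishing coefficient, of index [n] say, dominates the series
    at a large integer [j]: all later terms are smaller by a factor
    [((n + 1) / (n + 2)) ^ j], up to a constant, and this factor tends to 0. *)
Lemma H2_eval_eq0 f :
  (forall j : nat, (2 <= j)%N -> H2_eval f j%:R = 0) -> f = 0.
Proof.
move=> f0; suff fn0 n : f n = 0 by apply: val_inj; apply/funext => n; exact: fn0.
have [m] := ubnP n; elim: m n => // m IH n; rewrite ltnS => nm.
have {}IH i : (i < n)%N -> f i = 0 by move=> ni; apply: IH; exact: leq_trans ni nm.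
have term j i :
    normc (f i * cexp (- (j%:R : R[i]) * (ln i.+1%:R)%:C)) = normc (f i) * i.+1%:R ^- j.
  by rewrite normcM normc_dirichlet re_nat expR_ln_nat.
have : cvgn (series (fun i => normc (f i) * i.+1%:R ^- 2)).
  rewrite (_ : (fun _ => _) =
      fun i => normc (f i * cexp (- (2%:R : R[i]) * (ln i.+1%:R)%:C))).
    by apply: is_cvg_dirichlet_norm; rewrite re_nat ler1n.
  by apply/funext => i; rewrite term.
move=> /cvg_ex[C /= cC].
have C_ub N : series (fun i => normc (f i) * i.+1%:R ^- 2) N <= C.
  rewrite -(cvg_lim (@Rhausdorff R) cC); apply: nondecreasing_cvgn_le.
    apply: nondecreasing_series => i _ _.
    by rewrite mulr_ge0 ?normc_ge0 // invr_ge0 exprn_ge0.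
  by apply/cvg_ex; exists C.
pose r : R := n.+1%:R / n.+2%:R.
(* In the series at [j + 2], the sum at exponent 2 is at most [C], and in the
   tail [i > n] each of the other [j] factors [1 / (i + 1)] is at most
   [1 / (n + 2)]. *)
have bound j : normc (f n) <= C * n.+1%:R ^+ 2 * r ^+ j.
  have jj : 1 <= complex.Re (j.+2%:R : R[i]) by rewrite re_nat ler1n.
  have := is_cvg_dirichlet f _ jj.
  have := f0 j.+2 isT; rewrite /H2_eval => -> /cvgrPdist_lt c0.
  suff H : normc (f n) * n.+1%:R ^- j.+2 <= n.+2%:R ^- j * C.
    move: H; rewrite ler_pdivrMr ?exprn_gt0 // => /le_trans; apply.
    rewrite le_eqVlt; apply/orP; left; apply/eqP.
    rewrite /r expr_div_n -[j.+2]addn2 exprD.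
    by field; rewrite expf_neq0 //; lra.
  apply/ler_addgt0Pr => e e0.
  have /c0[M _ cM] : 0 < e%:C :> R[i] by rewrite ltcR.
  pose N := maxn M n.+1.
  have := cM N (leq_maxl _ _); rewrite sub0r normrN normcE ltcR.
  set S := series _ N => Se.
  rewrite -term; set t := _ * cexp _.
  rewrite -[t](subrK S) (le_trans (le_normcD _ _)) // lerD ?(ltW Se) //.
  have nN : (n < N)%N by rewrite leq_maxr.
  rewrite /S /series /= big_mkord (bigD1 (Ordinal nN)) //= opprD addrA.
  rewrite subrr sub0r normcN (le_trans (normc_sum _ _ _ _)) // mulrC.
  apply: (le_trans (y := \sum_(i < N)
    (normc (f i) * i.+1%:R ^- 2) * n.+2%:R ^- j)); last first.
    rewrite -mulr_suml ler_wpM2r ?invr_ge0 ?exprn_ge0 //.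
    by have := C_ub N; rewrite /series /= big_mkord.
  rewrite [leRHS](bigD1 (Ordinal nN)) //= ler_wpDl //.
    by rewrite !mulr_ge0 ?normc_ge0 ?invr_ge0 ?exprn_ge0.
  apply: ler_sum => i ni; rewrite term -mulrA.
  have [/IH ->|] := ltnP i n; first by rewrite normc0 !mul0r.
  rewrite leq_eqVlt => /orP[/eqP/esym/eqP|ni'].
    by rewrite -[i == n :> nat]/(i == Ordinal nN) (negPf ni).
  rewrite ler_wpM2l ?normc_ge0 // -[j.+2]addn2 exprD invfM mulrC.
  by rewrite ler_wpM2l ?invr_ge0 ?exprn_ge0 // lef_pV2 ?posrE ?exprn_gt0 //
    lerXn2r ?nnegrE // ler_nat.

apply/eq0_normc/le_anti; rewrite normc_ge0 andbT.
have r1 : `|r| < 1 by rewrite ger0_norm ?divr_ge0 // ltr_pdivrMr // mul1r ltr_nat.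
have cr : (fun j => C * n.+1%:R ^+ 2 * r ^+ j) @ \oo --> (C * n.+1%:R ^+ 2 * 0 : R).
  by apply: cvgMr; exact: cvg_expr.
rewrite -(mulr0 (C * n.+1%:R ^+ 2)) -(cvg_lim (@Rhausdorff R) cr).
by apply: limr_ge; [exact: cvgP cr|exact: nearW].
Qed.

Lemma composition_operator_unique (psi : R[i] -> R[i]) (A B : bounded_operator R) :
  is_composition_operator psi A -> is_composition_operator psi B ->
  forall f, A f = B f.
Proof.
move=> hA hB f; apply/eqP; rewrite -subr_eq0; apply/eqP/H2_eval_eq0 => j j2.
have j1 : 1 <= j%:R :> R by rewrite ler1n; exact: leq_trans j2.
have jhalf : 2^-1 < complex.Re (j%:R : R[i]) by rewrite re_nat; lra.
by rewrite H2_evalB ?re_nat // hA // hB // subrr.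
Qed.

End Dirichlet.

(** * Operators sending basis vectors to multiples of basis vectors *)

Section Operators.
Context {R : realType}.
Implicit Types f g : H2 R.

(** The image coefficients are those of [f], damped by [w] and moved to distinct
    places, whence a norm at most that of [f]. *)
Lemma exists_weighted_shift (k : nat -> nat) (w : nat -> R[i]) :
  {homo k : m n / (m < n)%N} -> (forall n, normc (w n) <= 1) ->
  exists T : bounded_operator R,
    forall f, coef (T f) = push k (fun n => f n * w n : R[i]^o).
Proof.
move=> k_mono w1.
have norm_le f n : normc (f n * w n) ^+ 2 <= normc (f n) ^+ 2.
  by rewrite lerXn2r ?nnegrE ?normc_ge0 // normcM ler_piMr ?normc_ge0.
have cvg_fw f : cvgn (series (fun n => normc (f n * w n) ^+ 2)).
  apply: series_le_cvg (norm_le f) (square_summableP f) => n;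
  exact: sqr_ge0.
have norm_push f : (fun m => normc (push k (fun n => f n * w n : R[i]^o) m) ^+ 2)
    = push k (fun n => normc (f n * w n) ^+ 2).
  apply: (push_comp k (fun z : R[i]^o => normc z ^+ 2)) => //.
  by rewrite normc0 expr0n.
have summable f : square_summable_pred (push k (fun n => f n * w n : R[i]^o)).
  apply/asboolP; rewrite /square_summable norm_push.
  have /cvg_ex[l /= fl] := cvg_fw f.
  by apply/cvg_ex; exists l; exact: cvg_series_push.
pose T0 f := MkH2 (summable f).
have T0_linear : linear T0.
  move=> c f g; apply: val_inj; apply/funext => m.
  rewrite -[LHS]/(push k _ m) -[RHS]/(c * push k _ m + push k _ m).
  have [[n ->]|no] := push_index_spec k m; last by rewrite !push_notin // mulr0 addr0.
  rewrite !push_image // -[X in X * _]/(c * f n + g n); ring.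
pose T1 : {linear H2 R -> H2 R} :=
  HB.pack T0 (GRing.isLinear.Build R[i] (H2 R) (H2 R) *:%R T0 T0_linear).
have T1_bounded : exists M : R, forall f, H2_norm (T1 f) <= M * H2_norm f.
  exists 1 => f; rewrite mul1r ler_wsqrtr //.
  have /cvg_ex[l /= fl] := cvg_fw f.
  have -> : limn (series (fun m => normc (T1 f m) ^+ 2)) = l.
    apply: cvg_lim; first exact: Rhausdorff.
    by have := cvg_series_push _ _ _ k_mono fl; rewrite -norm_push.
  rewrite -(cvg_lim (@Rhausdorff R) fl).
  by apply: lim_series_le => //; exact: square_summableP.
by exists (BoundedOperator T1_bounded).
Qed.

Lemma exists_basis (i : nat) : exists e : H2 R, forall n, e n = (n == i)%:R.
Proof.
have s : square_summable_pred (fun n => (n == i)%:R : R[i]^o).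
  apply/asboolP; apply/cvg_ex; exists (normc ((i == i)%:R : R[i]) ^+ 2).
  apply: cvg_near_cst; exists i.+1 => // N /= iN.
  apply: (series_finite _ (fun n => normc ((n == i)%:R : R[i]) ^+ 2)) => // n /negPf ->.
  by rewrite normc0 expr0n.
by exists (MkH2 s).
Qed.

Lemma H2_dot_basis (i : nat) (e f : H2 R) :
  (forall n, e n = (n == i)%:R) -> H2_dot f e = f i.
Proof.
move=> ei; apply: cvg_lim; first exact: norm_hausdorff.
apply: cvg_near_cst; exists i.+1 => // N /= iN.
rewrite (series_finite _ (fun n => f n * (e n)^* : R[i]^o) i) //.
  by rewrite ei eqxx rmorph1 mulr1.
by move=> n /negPf ni; rewrite ei ni rmorph0 mulr0.
Qed.

(** * Weak limits of polynomials in an operator *)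

Lemma WOT_continuous_dot f g : continuous (fun T : WOT R => H2_dot (T f) g).
Proof.
move=> T.
have H := @initial_continuous _ _ (fun T : bounded_operator R =>
  (fun fg : H2 R * H2 R => H2_dot (T fg.1) fg.2) : {ptws H2 R * H2 R -> R[i]^o}) T.
exact: (@continuous_comp _ _ _ _
  (fun u : {ptws H2 R * H2 R -> R[i]^o} => u (f, g)) T H
  (@proj_continuous _ (fun=> R[i]^o) _ _)).
Qed.

(** If [A] never produces the coefficient of index [k], then neither do its
    positive powers, and only the constant term of a polynomial in [A] acts on
    that coefficient. *)
Lemma alg_coef (A S : bounded_operator R) : alg A S ->
  exists c, forall k, (forall f, A f k = 0) -> forall f, S f k = c * f k.
Proof.
move=> [p Sp]; exists p`_0 => k Ak f; rewrite Sp.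
have [->|p0] := eqVneq p 0; first by rewrite size_poly0 big_ord0 coef0 mul0r.
have : (0 < size p)%N by rewrite size_poly_gt0.
case: (size p) => // s _; rewrite big_ord_recl.
set rest : H2 R := \sum_(m < s) _.
have rest0 : rest k = 0.
  rewrite /rest; elim/big_rec: _ => // m u _ u0.
  by rewrite -[LHS]/(_ * A (iter m A f) k + u k) u0 addr0 Ak mulr0.
by rewrite -[LHS]/(p`_0 * f k + rest k) rest0 addr0.
Qed.

(** The difference of the two diagonal matrix coefficients of [T] is weakly
    continuous in [T], and by [alg_coef] it vanishes on the polynomials in
    [A]. *)
Lemma closure_alg_coef_eq (A T : bounded_operator R) (i j : nat) (ei ej : H2 R) :
  (forall n, ei n = (n == i)%:R) -> (forall n, ej n = (n == j)%:R) ->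
  (forall f, A f i = 0) -> (forall f, A f j = 0) ->
  closure (alg A : set (WOT R)) T -> T ei i = T ej j.
Proof.
move=> hi hj Ai Aj.
pose F := fun T : WOT R => H2_dot (T ei) ei - H2_dot (T ej) ej.
have Fc : continuous F.
  move=> S; apply: cvgB; [exact: (nbhs_filter (S : WOT R))|exact: WOT_continuous_dot..].
have F0 : closed [set S | F S = 0].
  apply: ((continuous_closedP _).1 Fc [set 0]).
  exact/accessible_closed_set1/hausdorff_accessible/norm_hausdorff.
have sub : alg A `<=` [set S | F S = 0].
  move=> S /alg_coef[c Sc] /=.
  rewrite /F (H2_dot_basis _ _ _ hi) (H2_dot_basis _ _ _ hj) !Sc //.
  by rewrite hi hj !eqxx subrr.
move=> /(@closureS (WOT R) _ _ sub); rewrite -(closure_id _).1 // /F /=.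
rewrite (H2_dot_basis _ _ _ hi) (H2_dot_basis _ _ _ hj).
by move/eqP; rewrite subr_eq0 => /eqP.
Qed.

End Operators.

(** * The composition operator with symbol c0 s + c1 *)

Section Composition.
Context {R : realType} (c0 : nat) (c1 : R[i]).

(** Index of the term [(n + 1) ^ c0]: coefficients are numbered from zero. *)
Definition power_index (n : nat) : nat := (n.+1 ^ c0).-1.

(** The factor [(n + 1) ^ (- c1)]. *)
Definition twist (n : nat) : R[i] := cexp (- c1 * (ln n.+1%:R)%:C).

Hypothesis c0_ge2 : (2 <= c0)%N.

Let c0_gt0 : (0 < c0)%N. Proof. exact: leq_trans c0_ge2. Qed.

Lemma power_indexS n : (power_index n).+1 = (n.+1 ^ c0)%N.
Proof. by rewrite prednK // expn_gt0. Qed.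

Lemma power_index_mono : {homo power_index : m n / (m < n)%N}.
Proof. by move=> m n mn; rewrite -ltnS !power_indexS ltn_exp2r. Qed.

Lemma odd_power_index n : odd (power_index n) = odd n.
Proof.
apply: negb_inj; rewrite -!oddS power_indexS oddX.
by rewrite eqn0Ngt c0_gt0.
Qed.

(** The indices 1 and 2 stand for the numbers 2 and 3, which are not [c0]-th
    powers since they lie strictly between [1] and [2 ^ 2 <= 2 ^ c0]. *)
Lemma power_index_notin i : (0 < i < 3)%N -> forall n, power_index n <> i.
Proof.
move=> /andP[i0 i3] [|n].
  by rewrite /power_index exp1n => ni; rewrite -ni in i0.
move=> ni; have : (4 <= i.+1)%N; last by rewrite ltnS leqNgt i3.
rewrite -ni power_indexS (leq_trans (_ : 4 <= 2 ^ c0)%N) ?leq_exp2r //.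
by rewrite -[4%N]/(2 ^ 2)%N leq_exp2l.
Qed.

Hypothesis re_c1 : 0 <= complex.Re c1.

Lemma normc_twist_le1 n : normc (twist n) <= 1.
Proof.
rewrite normc_dirichlet -[leRHS]expR0 ler_expR mulNr oppr_le0.
by rewrite mulr_ge0 ?ln_ge0 ?ler1n.
Qed.

Let phi (s : R[i]) : R[i] := c0%:R * s + c1.

Lemma re_phi_ge1 s : 2^-1 < complex.Re s -> 1 <= complex.Re (phi s).
Proof.
move=> s2; rewrite /phi -(rmorph_nat (real_complex R)) mulrC.
have -> : complex.Re (s * c0%:R%:C + c1) = complex.Re s * c0%:R + complex.Re c1.
  by rewrite -re_mul_real; case: (s * _) c1 => [a b] [c d].
have : 2 <= c0%:R :> R by rewrite ler_nat.
move: c0%:R (complex.Re s) s2 re_c1 => x y.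
by nra.
Qed.

(** Term by term, [(n + 1) ^ (- c1) ((n + 1) ^ c0) ^ (- s)] equals
    [(n + 1) ^ (- phi s)]. The series of [f] at [phi s] converges because
    [Re (phi s) >= 1], and spreading its terms keeps its sum. *)
Lemma weighted_shift_composition (A : bounded_operator R) :
  (forall f, coef (A f) = push power_index (fun n => f n * twist n : R[i]^o)) ->
  is_composition_operator phi A.
Proof.
move=> Af f s s2; have /cvg_ex[l /= fl] := is_cvg_dirichlet f _ (re_phi_ge1 _ s2).
rewrite /H2_eval (cvg_lim _ fl); last exact: norm_hausdorff.
apply: cvg_lim; first exact: norm_hausdorff.
have := cvg_series_push _ _ _ power_index_mono fl.
congr (series _ @ \oo --> l); apply/funext => m; rewrite Af.
have [[n ->]|no] := push_index_spec power_index m; last first.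
  by rewrite !push_notin // mul0r.
rewrite !push_image; try exact: power_index_mono.
rewrite -mulrA /twist -cexpD power_indexS natrX lnXn //.
congr (_ * cexp _).
by rewrite rmorphMn /= -mulr_natr /phi; ring.
Qed.

End Composition.

(** * Failure of minimality *)

Theorem corollary6p3 (R : realType) (c0 : nat) (c1 : R[i])
    (hc0 : (2 <= c0)%N) (hc1 : 0 <= complex.Re c1) :
  let phi := fun s : R[i] => c0%:R * s + c1 in
  (exists A : bounded_operator R, is_composition_operator phi A) /\
  (forall A : bounded_operator R,
     is_composition_operator phi A -> ~ minimal_commutant A).
Proof.
move=> phi.
have k_mono := @power_index_mono _ hc0.
have [A0 A0E] := exists_weighted_shift _ _ k_mono (normc_twist_le1 _ hc1).
have A0_comp := weighted_shift_composition _ _ hc0 hc1 _ A0E.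
split; first by exists A0.
move=> A A_comp minA.
have AE f : coef (A f) = push (power_index c0) (fun n => f n * twist c1 n : R[i]^o).
  by rewrite (composition_operator_unique _ _ _ A_comp A0_comp).
(* The number [n + 1] is even when the index [n] is odd. *)
have [T TE] : exists T : bounded_operator R,
    forall f, coef (T f) = push id (fun n => f n * (odd n)%:R : R[i]^o).
  apply: exists_weighted_shift => // n.
  by case: odd; rewrite ?normc1 ?normc0.
have Tn f n : T f n = f n * (odd n)%:R by rewrite TE (push_image id).
have comm : commutant A T.
  move=> f; apply: val_inj; apply/funext => m.
  rewrite -[LHS]/(T (A f) m) -[RHS]/(A (T f) m) Tn !AE.
  have [[n ->]|no] := push_index_spec (power_index c0) m; last first.
    by rewrite !push_notin // mul0r.
  by rewrite !push_image // Tn odd_power_index // mulrAC.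
have A_notin i : (0 < i < 3)%N -> forall f, A f i = 0.
  by move=> hi f; rewrite AE push_notin //; exact: power_index_notin.
have [e1 e1E] := @exists_basis R 1.
have [e2 e2E] := @exists_basis R 2.
have : closure (alg A : set (WOT R)) T by rewrite minA.
move=> /(closure_alg_coef_eq _ _ _ _ _ _ e1E e2E (A_notin 1 isT) (A_notin 2 isT)).
rewrite !Tn e1E e2E /= mulr1 mulr0 => /eqP.
by rewrite oner_eq0.
Qed.
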